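(* For all integers $n,m\geq 0$ and any indeterminate $y$, \begin{align*} \sum_{k=0}^{n}\binom{n}{k}A_{n+m,m+k}(\mathbf{t})\,y^{k} &= \sum_{k=0}^{n}(-1)^{n-k}\binom{n}{k}\mathcal{Y}_{m+k}(\mathbf{t})(y+1)^{k}t_1^{n-k+1},\\ \sum_{k=0}^{n}\binom{n}{k}A_{m+k,m}(\mathbf{t})\,y^{n-k} &= t_1\sum_{k=0}^{n}\binom{n}{k}\mathcal{Y}_{m+k}(\mathbf{t})(y-t_1)^{n-k}. \end{align*}
   Context: $t_1,t_2,\dots$ are indeterminates. For a set partition $\pi$ assign each block of size $j$ the weight $t_j$, and let $w(\pi)$ be the product of its block weights. $\mathcal{Y}_n(\mathbf{t})$ is the sum of $w(\pi)$ over all partitions $\pi$ of $[n]=\{1,\dots,n\}$ ($\mathcal{Y}_0=1$). For $0\le k\le n$, $A_{n,k}(\mathbf{t})$ is the sum of $w(\pi)$ over all partitions of $[n+1]$ whose largest singleton block is $\{k+1\}$ (i.e. $\{k+1\}$ is a block and no $\{i\}$ with $i>k+1$ is a block). *)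

(* Defs.v *)
From HB Require Import structures.
From mathcomp Require Import all_boot all_order all_algebra.

Set Implicit Arguments.
Unset Strict Implicit.
Unset Printing Implicit Defensive.

Import GRing.Theory.
Local Open Scope ring_scope.

(* The set [n] = {1, ..., n} is represented by 'I_n, with i in [n]            *)
(* corresponding to the ordinal of value i - 1.  The indeterminates are an    *)
(* arbitrary sequence t of elements of an arbitrary commutative ring R: taking*)
(* for R a polynomial ring gives genuine indeterminates.  t 0 is never used,  *)
(* since the blocks of a partition are nonempty.                              *)

Definition part_weight (R : comNzRingType) (t : nat -> R) (n : nat)
    (P : {set {set 'I_n}}) : R :=
  \prod_(B in P) t #|B|.

Definition Ypoly (R : comNzRingType) (t : nat -> R) (n : nat) : R :=
  \sum_(P : {set {set 'I_n}} | partition P [set: 'I_n]) part_weight t P.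

Definition largest_singleton (n : nat) (P : {set {set 'I_n}}) (i : 'I_n) :=
  ([set i] \in P) && [forall j : 'I_n, (i < j)%N ==> ([set j] \notin P)].

(* The ordinal of value k represents the element k + 1 of [n + 1].  For k > n *)
(* there is no such ordinal, and the sum is empty.                            *)
Definition Apoly (R : comNzRingType) (t : nat -> R) (n k : nat) : R :=
  \sum_(P : {set {set 'I_n.+1}} | partition P [set: 'I_n.+1] &&
          [exists i : 'I_n.+1, (i == k :> nat) && largest_singleton P i])
    part_weight t P.

(* Main.v *)
(** Let [L] be the linear functional on polynomials with [L ('X^n) = Y_n].
    Whether [{u}] is a block or not gives, for partitions of a set of [a + b]
    elements without singletons in a prescribed subset of [b] elements, the
    total weight [L ('X^a * ('X - t_1)^b)]; removing the largest singleton
    block yields [A_(a+b,a) = t_1 L ('X^a * ('X - t_1)^b)].  The identities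
    are then [t_1 L] applied to the two binomial expansions of
    ['X^m * ((y + 1) 'X - t_1)^n] and of ['X^m * ('X + y - t_1)^n]. *)
Require Import Defs.
From HB Require Import structures.
From mathcomp Require Import all_boot all_order all_algebra.
From mathcomp Require Import ring.

Set Implicit Arguments.
Unset Strict Implicit.
Unset Printing Implicit Defensive.

Import GRing.Theory.
Local Open Scope ring_scope.

(** The ground set is a subset [S] of a fixed type, so that deleting a point changes [S] to [S :\ u]
    but leaves the type of the blocks alone. *)
Definition avoiding_sum (R : comNzRingType) (t : nat -> R) (T : finType)
    (S U : {set T}) : R :=
  \sum_(P : {set {set T}} | partition P S && [forall i in U, [set i] \notin P])
    \prod_(B in P) t #|B|.

(** An enumeration of [S] by ['I_#|S|] transports partitions blockwise and preserves block sizes,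
    hence weights. *)
Lemma avoiding_sum0 (R : comNzRingType) (t : nat -> R) (T : finType)
    (S : {set T}) :
  avoiding_sum t S set0 = Ypoly t #|S|.
Proof.
rewrite /avoiding_sum /Ypoly.
pose f : 'I_#|S| -> T := enum_val.
have injf : injective f by exact: enum_val_inj.
have fT : f @: setT = S.
  apply/setP=> x; apply/imsetP/idP => [[i _ ->]|xS]; first exact: enum_valP.
  by exists (enum_rank_in xS x); rewrite // /f enum_rankK_in.
pose h (P : {set {set 'I_#|S|}}) := [set f @: (B : {set _}) | B in P].
pose h' (Q : {set {set T}}) := [set f @^-1: (B : {set _}) | B in Q].
have fK (B : {set 'I_#|S|}) : f @^-1: (f @: B) = B.
  by apply/setP=> x; rewrite inE mem_imset.
have hK P : h' (h P) = P.
  rewrite /h' /h -imset_comp -[RHS]imset_id; apply: eq_imset => B /=.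
  exact: fK.
rewrite (reindex_onto h h') => [|Q /andP[partQ _]] /=.
  apply: eq_big => [P|P _].
    have -> : partition (h P) S = partition P setT.
      by rewrite -(imset_partition P setT injf) fT.
    rewrite hK eqxx andbT; apply/andb_idr => _.
    by apply/forall_inP => i; rewrite inE.
  rewrite /part_weight big_imset /=; last by move=> A B _ _; apply: imset_inj.
  by apply: eq_bigr => B _; rewrite card_imset.
(* Taking preimages and then images gives back [Q] because every block of [Q] lies in [S], the image
   of [f]. *)
rewrite /h' /h -imset_comp -[RHS]imset_id; apply: eq_in_imset => B BQ /=.
apply/setP=> x; apply/imsetP/idP => [[i]|xB]; first by rewrite inE => ? ->.
have: x \in f @: setT by rewrite fT (subsetP (partitionS partQ BQ)).
by case/imsetP=> i _ xE; exists i; rewrite // inE -xE.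
Qed.

(** Adjoining [[set u]] is a bijection from the partitions of [S :\ u] onto those of [S] with this
    block, and it multiplies the weight by [t 1]. The free condition [Q] lets this serve both the
    recursion on forbidden singletons and the removal of the largest singleton. *)
Lemma sum_partition_singleton (R : comNzRingType) (t : nat -> R) (T : finType)
    (S : {set T}) (u : T) (Q : pred {set {set T}}) : u \in S ->
  \sum_(P : {set {set T}} | [&& partition P S, [set u] \in P & Q P])
    \prod_(B in P) t #|B|
  = t 1%N * \sum_(P : {set {set T}} | partition P (S :\ u) && Q ([set u] |: P))
    \prod_(B in P) t #|B|.
Proof.
move=> uS; rewrite big_distrr /=.
have uNP P : partition P (S :\ u) -> [set u] \notin P.
  move=> partP; apply/negP => /(partitionS partP) /subsetP/(_ u).
  by rewrite !inE eqxx => /(_ isT).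
rewrite (reindex_onto (fun P => [set u] |: P) (fun P => P :\ [set u])) /=.
  have condE P : [&& partition ([set u] |: P) S, [set u] \in [set u] |: P
      & Q ([set u] |: P)] && (([set u] |: P) :\ [set u] == P) =
      partition P (S :\ u) && Q ([set u] |: P).
    rewrite setU11 /=; apply/andP/andP => [[/andP[partP QP] /eqP defP]|].
      by split=> //; rewrite -{1}defP; apply: partitionD1 => //; rewrite setU11.
    case=> partP QP; split; last by rewrite setU1K ?uNP.
    rewrite QP andbT -(setD1K uS); apply: partitionU1 => //.
      by rewrite -card_gt0 cards1.
    by rewrite disjoints1 !inE eqxx.
  apply: eq_big => [|P]; first exact: condE.
  by rewrite condE => /andP[/uNP uP _]; rewrite big_setU1 //= cards1.
by move=> P /and3P[_ uP _]; rewrite setD1K.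
Qed.

(** Among the partitions that avoid singletons in [U], those that have [[set u]] as a block are
    subtracted. *)
Lemma avoiding_sumU1 (R : comNzRingType) (t : nat -> R) (T : finType)
    (S U : {set T}) (u : T) : u \in S -> u \notin U ->
  avoiding_sum t S (u |: U)
    = avoiding_sum t S U - t 1%N * avoiding_sum t (S :\ u) U.
Proof.
move=> uS uNU; apply/eqP; rewrite eq_sym subr_eq; apply/eqP.
rewrite {1}/avoiding_sum (bigID (fun P : {set {set T}} => [set u] \in P)) /=.
rewrite addrC; congr (_ + _).
  apply: eq_bigl => P; rewrite -andbA; congr (_ && _).
  apply/andP/forall_inP => [[/forall_inP UP uP] i /setU1P[->//|/UP//]|UP].
  split; last by rewrite UP ?setU11.
  by apply/forall_inP => i iU; rewrite UP // setU1r.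
under eq_bigl => P do rewrite -andbA [X in _ && X]andbC.
rewrite (sum_partition_singleton t
  (fun P => [forall i in U, [set i] \notin P]) uS).
congr (_ * _); apply: eq_bigl => P /=; congr (_ && _).
(* As [u] is not in [U], the adjoined block is none of the forbidden singletons. *)
apply: eq_forallb_in => i iU; rewrite !inE (inj_eq set1_inj).
by case: eqP uNU => // <-; rewrite iU.
Qed.

(** This is the functional [L]. *)
Definition umbral (R : comNzRingType) (t : nat -> R) (p : {poly R}) : R :=
  \sum_(i < size p) p`_i * Ypoly t i.

(** Linearity compares polynomials of different sizes, so their sums are brought to a common
    range. *)
Lemma umbral_widen (R : comNzRingType) (t : nat -> R) (p : {poly R}) (n : nat) :
  (size p <= n)%N -> umbral t p = \sum_(i < n) p`_i * Ypoly t i.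
Proof.
move=> le_pn; rewrite /umbral (big_ord_widen n (fun i => p`_i * Ypoly t i)) //.
rewrite big_mkcond /=; apply: eq_bigr => i _; case: ltnP => // le_pi.
by rewrite nth_default // mul0r.
Qed.

Lemma umbral_is_linear (R : comNzRingType) (t : nat -> R) :
  linear_for *%R (umbral t).
Proof.
move=> a p q.
have le_pq : (size (a *: p + q)%R <= maxn (size p) (size q))%N.
  rewrite (leq_trans (size_polyD _ _)) // geq_max leq_maxr.
  by rewrite (leq_trans (size_scale_leq _ _)) // leq_maxl.
rewrite (umbral_widen t le_pq) (umbral_widen t (leq_maxl (size p) (size q))).
rewrite (umbral_widen t (leq_maxr (size p) (size q))) big_distrr /= -big_split.
by apply: eq_bigr => i _; rewrite /= coefD coefZ mulrDl mulrA.
Qed.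

HB.instance Definition _ (R : comNzRingType) (t : nat -> R) :=
  GRing.isLinear.Build R {poly R} R *%R (umbral t) (umbral_is_linear t).

Lemma umbralXn (R : comNzRingType) (t : nat -> R) (n : nat) :
  umbral t 'X^n = Ypoly t n.
Proof.
rewrite /umbral size_polyXn (bigD1 ord_max) //= coefXn eqxx mul1r.
rewrite big1 ?addr0 // => i; rewrite -val_eqE coefXn => /negPf -> /=.
by rewrite mul0r.
Qed.

(** By induction on [b], the recursion on a point of [U] matches the expansion of one factor
    ['X - t_1]. *)
Lemma avoiding_sumE (R : comNzRingType) (t : nat -> R) (T : finType)
    (S U : {set T}) (a b : nat) : U \subset S -> #|S| = (a + b)%N -> #|U| = b ->
  avoiding_sum t S U = umbral t ('X^a * ('X - (t 1%N)%:P) ^+ b).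
Proof.
elim: b S U a => [|b IHb] S U a US cardS cardU.
  rewrite (cards0_eq cardU) avoiding_sum0 expr0 mulr1 umbralXn cardS.
  by rewrite addn0.
have /card_gt0P[u uU] : (0 < #|U|)%N by rewrite cardU.
have uS := subsetP US u uU.
have cardU' : #|U :\ u| = b by move: cardU; rewrite (cardsD1 u) uU => -[].
have cardS' : #|S :\ u| = (a + b)%N.
  by move: cardS; rewrite (cardsD1 u) uS addnS => -[].
rewrite -(setD1K uU) avoiding_sumU1 ?setD11 //.
(* In the first term [u] stays in [S] but becomes unrestricted, whence [a.+1]; in the second it
   leaves [S], and [a] is unchanged. *)
rewrite (IHb S _ a.+1) ?(IHb (S :\ u) _ a) ?setSD //; last 2 first.
- exact: subset_trans (subD1set U u) US.
- by rewrite cardS addnS.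
rewrite -linearZ -linearB /=; congr (umbral t _).
by rewrite exprSr (exprS ('X - _)) -mul_polyC; ring.
Qed.

Lemma ApolyE (R : comNzRingType) (t : nat -> R) (a b : nat) :
  Apoly t (a + b) a = t 1%N * umbral t ('X^a * ('X - (t 1%N)%:P) ^+ b).
Proof.
rewrite /Apoly; have lt_a : (a < (a + b).+1)%N by rewrite ltnS leq_addr.
(* The point [i] stands for the element [a + 1]: [a] unrestricted elements lie below it, and the [b]
   elements of [U] above it may not be singletons. *)
pose i := Ordinal lt_a; pose U := [set j : 'I_(a + b).+1 | (i < j)%N].
have iNU : i \notin U by rewrite inE ltnn.
have cardU : #|U| = b.
  transitivity #|@rshift a.+1 b @: setT|.
    congr #|pred_of_set _|; apply/setP => j; rewrite inE.
    apply/idP/imsetP => [lt_ij|[k _ ->]]; last by rewrite /= ltnS leq_addr.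
    have lt_jb : (j - a.+1 < b)%N by rewrite ltn_subLR.
    by exists (Ordinal lt_jb) => //; apply: val_inj; rewrite /= subnKC.
  by rewrite card_imset ?cardsT ?card_ord //; apply: rshift_inj.
rewrite -(@avoiding_sumE _ _ _ ([set: _] :\ i) U) //; first last.
- by move: (cardsD1 i setT); rewrite cardsT card_ord inE => -[].
- by rewrite subsetD1 subsetT.
under eq_bigl => P.
  have -> : [exists i0 : 'I_(a + b).+1, (i0 == a :> nat)
      && largest_singleton P i0] =
      ([set i] \in P) && [forall j in U, [set j] \notin P].
    apply/existsP/idP => [[k /andP[/eqP ka]]|Pi].
      have -> : k = i by apply: val_inj.
      by under eq_forallb => j do rewrite inE.
    exists i; rewrite eqxx; move: Pi.
    by under eq_forallb => j do rewrite inE.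
  over.
rewrite (sum_partition_singleton t
  (fun P => [forall j in U, [set j] \notin P]) (in_setT i)).
congr (_ * _); apply: eq_bigl => P /=; congr (_ && _).
apply: eq_forallb_in => j jU; rewrite !inE (inj_eq set1_inj).
by case: eqP iNU => // <-; rewrite jU.
Qed.

Theorem theorem2p6 (R : comNzRingType) (t : nat -> R) (y : R) (n m : nat) :
  \sum_(0 <= k < n.+1) 'C(n, k)%:R * Apoly t (n + m) (m + k) * y ^+ k
    = \sum_(0 <= k < n.+1) (-1) ^+ (n - k) * 'C(n, k)%:R * Ypoly t (m + k)
        * (y + 1) ^+ k * t 1%N ^+ (n - k + 1)
  /\
  \sum_(0 <= k < n.+1) 'C(n, k)%:R * Apoly t (m + k) m * y ^+ (n - k)
    = t 1%N * \sum_(0 <= k < n.+1) 'C(n, k)%:R * Ypoly t (m + k)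
        * (y - t 1%N) ^+ (n - k).
Proof.
split.
  have -> : \sum_(0 <= k < n.+1) 'C(n, k)%:R * Apoly t (n + m) (m + k) * y ^+ k
      = t 1%N * umbral t ('X^m * ('X - (t 1%N)%:P + y *: 'X) ^+ n).
    rewrite exprDn [X in umbral t X]mulr_sumr linear_sum mulr_sumr big_mkord /=.
    apply: eq_bigr => i _; have le_in : (i <= n)%N by rewrite -ltnS.
    (* This is the shape that [ApolyE] expects, with [m + i] unrestricted elements and [n - i]
       restricted ones. *)
    have -> : (n + m = m + i + (n - i))%N by rewrite -addnA subnKC // addnC.
    rewrite -[X in umbral t (_ * X)]mulr_natl ApolyE exprZn.
    have -> : 'X^m * ('C(n, i)%:R * (('X - (t 1%N)%:P) ^+ (n - i) *
        (y ^+ i *: 'X^i))) = ('C(n, i)%:R * y ^+ i) *: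
        ('X^(m + i) * ('X - (t 1%N)%:P) ^+ (n - i)) :> {poly R}.
      by rewrite -!mul_polyC polyCM polyC_natr exprD; ring.
    by rewrite linearZ /=; ring.
  (* Regrouped in this way, the binomial expansion involves only pure powers of ['X], which [umbral]
     sends to the [Ypoly] values. *)
  have -> : 'X - (t 1%N)%:P + y *: 'X = (- t 1%N)%:P + (y + 1) *: 'X.
    by rewrite scalerDl scale1r polyCN; ring.
  rewrite exprDn [X in umbral t X]mulr_sumr linear_sum mulr_sumr big_mkord /=.
  apply: eq_bigr => i _; rewrite -[X in umbral t (_ * X)]mulr_natl exprZn -polyC_exp.
  have -> : 'X^m * ('C(n, i)%:R * (((- t 1%N) ^+ (n - i))%:P *
      ((y + 1) ^+ i *: 'X^i))) = ('C(n, i)%:R * (- t 1%N) ^+ (n - i)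
      * (y + 1) ^+ i) *: 'X^(m + i) :> {poly R}.
    by rewrite -!mul_polyC !polyCM polyC_natr exprD; ring.
  (* The sign comes from the power of [- t 1], and the outer factor [t 1] raises the exponent to
     [n - i + 1]. *)
  by rewrite linearZ /= umbralXn (exprNn (t 1%N)) exprD expr1; ring.
have -> : \sum_(0 <= k < n.+1) 'C(n, k)%:R * Apoly t (m + k) m * y ^+ (n - k)
    = t 1%N * umbral t ('X^m * (y%:P + ('X - (t 1%N)%:P)) ^+ n).
  rewrite exprDn [X in umbral t X]mulr_sumr linear_sum mulr_sumr big_mkord /=.
  apply: eq_bigr => i _; rewrite -[X in umbral t (_ * X)]mulr_natl ApolyE -polyC_exp.
  have -> : 'X^m * ('C(n, i)%:R * ((y ^+ (n - i))%:P *
      ('X - (t 1%N)%:P) ^+ i)) = ('C(n, i)%:R * y ^+ (n - i)) *: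
      ('X^m * ('X - (t 1%N)%:P) ^+ i) :> {poly R}.
    by rewrite -!mul_polyC polyCM polyC_natr; ring.
  by rewrite linearZ /=; ring.
(* Here the constant [- t 1] joins [y] instead of ['X], and the factor [t 1] stays outside the
   sum. *)
have -> : y%:P + ('X - (t 1%N)%:P) = (y - t 1%N)%:P + 'X.
  by rewrite polyCB; ring.
congr (_ * _); rewrite exprDn [X in umbral t X]mulr_sumr linear_sum big_mkord /=.
apply: eq_bigr => i _; rewrite -[X in umbral t (_ * X)]mulr_natl -polyC_exp.
have -> : 'X^m * ('C(n, i)%:R * (((y - t 1%N) ^+ (n - i))%:P * 'X^i))
    = ('C(n, i)%:R * (y - t 1%N) ^+ (n - i)) *: 'X^(m + i) :> {poly R}.
  by rewrite -!mul_polyC polyCM polyC_natr exprD; ring.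
by rewrite linearZ /= umbralXn; ring.
Qed.
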